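(* Let $P$ be a process of the probabilistic multiparty session calculus, and let $\Gamma_1,\Gamma_2$ be sortings and $\Delta_1,\Delta_2$ typings with $\mathit{erase}(\Delta_1)=\mathit{erase}(\Delta_2)$ and $\mathit{erase}(\Gamma_1)=\mathit{erase}(\Gamma_2)$. If $\Gamma_1\vdash P\rhd\Delta_1$ and $\Gamma_2\vdash P\rhd\Delta_2$, then $\Gamma_1\cap\Gamma_2\vdash P\rhd\Delta_1\cap\Delta_2$.
   Context: Syntax. Fix session names $s$, roles $r$, labels $l$, variables $x$, process variables $X$, base values $v$ and base sorts $S$. Channels $c ::= x\mid s[r]$. Processes: $P,Q ::= c[r]\oplus_{i\in I}\langle p_i : l_i(v_i); P_i\rangle \mid c[r]\,\&_{i\in I}\{l_i(x_i);P_i\} \mid (\nu s)P \mid \mathsf{def}\ D\ \mathsf{in}\ P \mid X(\tilde v) \mid \mathbf 0 \mid P\mid Q$, $D ::= X(\tilde x)=P$, $I\neq\emptyset$, labels pairwise distinct, $p_i\in[0,1]$, $x_i$ bound in $P_i$. Types. Imprecise probability $\delta=[d_1,d_2]$ with $0\le d_1\le d_2\le1$, $p\in\delta$ iff $d_1\le p\le d_2$. Global types $G ::= r_1\to r_2:\{\delta_i:l_i(S_i).G_i\}_{i\in I}\mid\mu t.G\mid t\mid\mathsf{end}$; local types $T ::= r\oplus_{i\in I}\delta_i:!l_i\langle S_i\rangle.T_i\mid r\,\&_{i\in I}?l_i(S_i).T_i\mid\mu t.T\mid t\mid\mathsf{end}$. Projection $G\upharpoonright r$: for $G=r_1\to r_2:\{\delta_i:l_i(S_i).G_i\}$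 it is $r_1\oplus_i\delta_i:!l_i\langle S_i\rangle.(G_i\upharpoonright r)$ if $r=r_1\ne r_2$, $r_2\,\&_i?l_i(S_i).(G_i\upharpoonright r)$ if $r=r_2\ne r_1$, $G_1\upharpoonright r$ if $r\notin\{r_1,r_2\}$ and all $G_i\upharpoonright r$ coincide; $(\mu t.G)\upharpoonright r=\mu t.(G\upharpoonright r)$ if this is not $\mathsf{end}$, else $\mathsf{end}$; $t\upharpoonright r=t$; $\mathsf{end}\upharpoonright r=\mathsf{end}$; undefined otherwise. Typing. Sortings $\Gamma ::= \emptyset\mid\Gamma,x:S\mid\Gamma,X:\tilde S\tilde T$; typings $\Delta ::= \emptyset\mid\Delta,\{s[r_i]:T_i\}_{i\in I}$; $\Delta,\Delta'$ is union with disjoint domains; ''$\Delta$ end only'': all types are $\mathsf{end}$. Rules: (TVar) $\Gamma,x:S\vdash x:S$; (TVal) $\Gamma\vdash v:S$; (TSelect) if $\forall i$: $\Gamma\vdash v_i:S_i$, $\Gamma\vdash P_i\rhd\Delta,c:T_i$, and $\sum_ip_i=1$, $p_i\in\delta_i$, then $\Gamma\vdash c[r]\oplus_{i\in I}\langle p_i:l_i(v_i);P_i\rangle\rhd\Delta,c:r\oplus_{i\in I}\delta_i:!l_i\langle S_i\rangle.T_i$; (TBranch) if $\forall i$: $\Gamma,x_i:S_i\vdash P_i\rhd\Delta,c:T_i$ then $\Gamma\vdash c[r]\&_{i\in I}\{l_i(x_i);P_i\}\rhd\Delta,c:r\&_{i\in I}?l_i(S_i).T_i$; (TEnd) $\Delta$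 end only $\Rightarrow\Gamma\vdash\mathbf 0\rhd\Delta$; (TConc) $\Gamma\vdash P\rhd\Delta$, $\Gamma\vdash Q\rhd\Delta'$ $\Rightarrow\Gamma\vdash P\mid Q\rhd\Delta,\Delta'$; (TRes) if $G$ has $|I|$ participants, $G\upharpoonright r_i=T_i$ for all $i$, and $\Gamma\vdash P\rhd\Delta,\{s[r_i]:T_i\}_{i\in I}$, then $\Gamma\vdash(\nu s)P\rhd\Delta$; (TDef) $\Gamma,\tilde x:\tilde S,X:\tilde ST_1\dots T_n\vdash P\rhd c_1:T_1,\dots,c_n:T_n$ and $\Gamma,X:\tilde ST_1\dots T_n\vdash Q\rhd\Delta$ $\Rightarrow\Gamma\vdash\mathsf{def}\ X(\tilde xc_1\dots c_n)=P\ \mathsf{in}\ Q\rhd\Delta$; (TCall) $\Gamma\vdash\tilde v:\tilde S$ and $\Delta$ end only $\Rightarrow\Gamma,X:\tilde ST_1\dots T_n\vdash X(\tilde vc_1\dots c_n)\rhd\Delta,c_1:T_1,\dots,c_n:T_n$. Erasure and intersection. $\mathit{erase}$ removes all imprecise-probability annotations from a local type, and is applied pointwise to typings and sortings. For local types $T_1,T_2$ with equal erasure, $T_1\cap T_2$ is: $r\oplus_{i\in I}(\delta_{1i}\cap\delta_{2i}):!l_i\langle S_i\rangle.(T_{1i}\cap T_{2i})$ if $T_j=r\oplus_{i\in I}\delta_{ji}:!l_i\langle S_i\rangle.T_{ji}$ ($j=1,2$) and all $\delta_{1i}\cap\delta_{2i}\ne\emptyset$ (interval intersection); $r\&_{i\in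 I}?l_i(S_i).(T_{1i}\cap T_{2i})$ if $T_j=r\&_{i\in I}?l_i(S_i).T_{ji}$; $\mu t.(T'_1\cap T'_2)$ if $T_j=\mu t.T'_j$; $T_1$ if $T_1=T_2=t$ or $T_1=T_2=\mathsf{end}$; undefined otherwise. For typings, $\Delta_1\cap\Delta_2=\{s[r]:T_1\cap T_2\mid s[r]:T_1\in\Delta_1,\ s[r]:T_2\in\Delta_2\}$. The intersection $\Gamma_1\cap\Gamma_2$ of sortings with equal erasure is defined in the same manner, intersecting the local types occurring in corresponding entries $X:\tilde S\tilde T$ componentwise.
   Formalization: The formal theorem assumes that Γ1∩Γ2 and Δ1∩Δ2 are defined; equal erasure does not ensure this (e.g. P = 0 with Γj = X:Tj and disjoint intervals in T1, T2, where Γ1∩Γ2 is undefined). *)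

(* Defs.v *)
From HB Require Import structures.
From mathcomp Require Import all_boot all_order all_algebra.
From mathcomp Require Import finmap.

Set Implicit Arguments.
Unset Strict Implicit.
Unset Printing Implicit Defensive.

Import Order.TTheory GRing.Theory Num.Theory.

Local Open Scope ring_scope.
Local Open Scope fset_scope.
Local Open Scope fmap_scope.

(* Binders are represented by de Bruijn indices, so syntax is taken up to
   alpha-conversion and bound names are automatically fresh.  There are
   separate index spaces for session names, process variables, type variables,
   variables of base sort and channel variables; a free name is an index that
   points past all enclosing binders.

   A family indexed by a finite set I is a list whose positions are the elements
   of I: a process and its type list their alternatives in the same order.  The
   requirements "I is nonempty" and "labels are pairwise distinct" are the
   predicates wf_ltype, wf_gtype and wf_proc. *)

Definition role := nat.
Definition label := nat.

(** * Pointwise lifting of a partial operation to lists *)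

Section OptionZip.
Variables (A B C : Type) (f : A -> B -> option C).

Fixpoint ozip (s : seq A) (t : seq B) : option (seq C) :=
  match s, t with
  | [::], [::] => Some [::]
  | a :: s', b :: t' =>
      match f a b, ozip s' t' with
      | Some c, Some u => Some (c :: u)
      | _, _ => None
      end
  | _, _ => None
  end.

End OptionZip.

(** * Channels *)

Inductive chan : Type :=
| CVar of nat
| CSess of nat & role.

Definition chan_code (c : chan) : nat + nat * role :=
  match c with CVar x => inl x | CSess s r => inr (s, r) end.

Definition chan_decode (u : nat + nat * role) : chan :=
  match u with inl x => CVar x | inr sr => CSess sr.1 sr.2 end.

Lemma chan_codeK : cancel chan_code chan_decode.
Proof. by case. Qed.

HB.instance Definition _ := Choice.copy chan (can_type chan_codeK).

(* Renaming of channels when passing under a restriction, and its left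
   inverse. *)
Definition chan_up (c : chan) : chan :=
  match c with CVar x => CVar x | CSess s r => CSess s.+1 r end.

Definition chan_down (c : chan) : chan :=
  match c with CVar x => CVar x | CSess s r => CSess s.-1 r end.

Lemma chan_upK : cancel chan_up chan_down.
Proof. by case. Qed.

(** * Probabilities and imprecise probabilities *)

Definition prob (R : realFieldType) : Type := {p : R | 0 <= p <= 1}.

Definition impr (R : realFieldType) : Type :=
  {d : R * R | [&& 0 <= d.1, d.1 <= d.2 & d.2 <= 1]}.

Definition in_impr (R : realFieldType) (p : prob R) (d : impr R) : bool :=
  (val d).1 <= val p <= (val d).2.

(* None exactly when the two intervals are disjoint. *)
Definition impr_cap (R : realFieldType) (d1 d2 : impr R) : option (impr R) :=
  insub (Num.max (val d1).1 (val d2).1, Num.min (val d1).2 (val d2).2).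

(** * Types *)

(* One alternative  ann : lab(srt).cont  of a communication. *)
Record branch (Sort A T : Type) : Type :=
  Branch { ann : A; lab : label; srt : Sort; cont : T }.

Definition with_ann (Sort A B T : Type) (a : B) (b : branch Sort A T) :
  branch Sort B T := Branch a (lab b) (srt b) (cont b).

Definition with_cont (Sort A T U : Type) (t : U) (b : branch Sort A T) :
  branch Sort A U := Branch (ann b) (lab b) (srt b) t.

(* Types are parameterized by the annotations of their sending alternatives:
   the types of the calculus have annotations in impr R, erased types have
   annotations in unit. *)
Inductive ltype (Sort A : Type) : Type :=
| LSelect (r : role) (bs : seq (branch Sort A (ltype Sort A)))
| LBranch (r : role) (bs : seq (branch Sort unit (ltype Sort A)))
| LMu of ltype Sort A
| LVar of nat
| LEnd.

Arguments LVar {Sort A}.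
Arguments LEnd {Sort A}.

Inductive gtype (Sort A : Type) : Type :=
| GComm (r1 r2 : role) (bs : seq (branch Sort A (gtype Sort A)))
| GMu of gtype Sort A
| GVar of nat
| GEnd.

Arguments GVar {Sort A}.
Arguments GEnd {Sort A}.

Fixpoint wf_ltype (Sort A : Type) (T : ltype Sort A) : bool :=
  match T with
  | LSelect _ bs =>
      [&& (0 < size bs)%N, uniq [seq lab b | b <- bs]
        & all (fun b => wf_ltype (cont b)) bs]
  | LBranch _ bs =>
      [&& (0 < size bs)%N, uniq [seq lab b | b <- bs]
        & all (fun b => wf_ltype (cont b)) bs]
  | LMu T' => wf_ltype T'
  | LVar _ | LEnd => true
  end.

Fixpoint wf_gtype (Sort A : Type) (G : gtype Sort A) : bool :=
  match G with
  | GComm _ _ bs =>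
      [&& (0 < size bs)%N, uniq [seq lab b | b <- bs]
        & all (fun b => wf_gtype (cont b)) bs]
  | GMu G' => wf_gtype G'
  | GVar _ | GEnd => true
  end.

(* With repetitions. *)
Fixpoint participants (Sort A : Type) (G : gtype Sort A) : seq role :=
  match G with
  | GComm r1 r2 bs =>
      r1 :: r2 :: flatten [seq participants (cont b) | b <- bs]
  | GMu G' => participants G'
  | GVar _ | GEnd => [::]
  end.

(* [proj G r T] : the projection of G on r is defined and equal to T.  Pitfall:
   the prefix of the projection of a communication r1 -> r2 on its sender
   (receiver) carries r1 (r2), the role on which one projects, not its
   partner. *)
Inductive proj (Sort A : Type) :
  gtype Sort A -> role -> ltype Sort A -> Prop :=
| proj_sender r1 r2 bs Ts :
    r1 <> r2 ->
    size Ts = size bs ->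
    (forall i b T, onth bs i = Some b -> onth Ts i = Some T ->
       proj (cont b) r1 T) ->
    proj (GComm r1 r2 bs) r1
         (LSelect r1 [seq with_cont bT.2 bT.1 | bT <- zip bs Ts])
| proj_receiver r1 r2 bs Ts :
    r1 <> r2 ->
    size Ts = size bs ->
    (forall i b T, onth bs i = Some b -> onth Ts i = Some T ->
       proj (cont b) r2 T) ->
    proj (GComm r1 r2 bs) r2
         (LBranch r2 [seq with_ann tt (with_cont bT.2 bT.1) | bT <- zip bs Ts])
| proj_other r1 r2 bs r T :
    r <> r1 -> r <> r2 ->
    (0 < size bs)%N ->
    (forall i b, onth bs i = Some b -> proj (cont b) r T) ->
    proj (GComm r1 r2 bs) r T
| proj_mu G r T :
    proj G r T -> T <> LEnd -> proj (GMu G) r (LMu T)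
| proj_mu_end G r :
    proj G r LEnd -> proj (GMu G) r LEnd
| proj_var t r : proj (GVar t) r (LVar t)
| proj_end r : proj GEnd r LEnd.

Fixpoint lerase (Sort A : Type) (T : ltype Sort A) : ltype Sort unit :=
  match T with
  | LSelect r bs =>
      LSelect r [seq with_ann tt (with_cont (lerase (cont b)) b) | b <- bs]
  | LBranch r bs =>
      LBranch r [seq with_cont (lerase (cont b)) b | b <- bs]
  | LMu T' => LMu (lerase T')
  | LVar t => LVar t
  | LEnd => LEnd
  end.

(* The partial operation T1 /\ T2. *)
Fixpoint lcap (R : realFieldType) (Sort : eqType)
    (T1 T2 : ltype Sort (impr R)) : option (ltype Sort (impr R)) :=
  match T1, T2 with
  | LSelect r1 bs1, LSelect r2 bs2 =>
      if r1 == r2 then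
        omap (LSelect r1) (ozip (fun b1 b2 =>
          if (lab b1 == lab b2) && (srt b1 == srt b2) then
            match impr_cap (ann b1) (ann b2), lcap (cont b1) (cont b2) with
            | Some d, Some T => Some (Branch d (lab b1) (srt b1) T)
            | _, _ => None
            end
          else None) bs1 bs2)
      else None
  | LBranch r1 bs1, LBranch r2 bs2 =>
      if r1 == r2 then
        omap (LBranch r1) (ozip (fun b1 b2 =>
          if (lab b1 == lab b2) && (srt b1 == srt b2) then
            omap (Branch tt (lab b1) (srt b1)) (lcap (cont b1) (cont b2))
          else None) bs1 bs2)
      else None
  | LMu T1', LMu T2' => omap (@LMu Sort (impr R)) (lcap T1' T2')
  | LVar t1, LVar t2 => if t1 == t2 then Some (LVar t1) else None
  | LEnd, LEnd => Some LEnd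
  | _, _ => None
  end.

(** * Processes *)

Inductive expr (Val : Type) : Type :=
| EVar of nat
| EVal of Val.

Arguments EVar {Val}.

(* One alternative  <sprob : slab(sval); scont>  of a selection. *)
Record sbranch (R : realFieldType) (Val P : Type) : Type :=
  SBranch { sprob : prob R; slab : label; sval : expr Val; scont : P }.

(* - Each alternative of PBranch binds one variable of base sort.
   - PRes binds a session name.
   - PDef k n P Q is  def X(x_1 ... x_k c_1 ... c_n) = P in Q: it binds X in P
     and Q, and, in P only, k variables of base sort and n channel variables
     (the first parameter has index 0). *)
Inductive proc (R : realFieldType) (Val : Type) : Type :=
| PSelect (c : chan) (r : role) (bs : seq (sbranch R Val (proc R Val)))
| PBranch (c : chan) (r : role) (bs : seq (label * proc R Val))
| PRes (P : proc R Val)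
| PDef (k n : nat) (P Q : proc R Val)
| PCall (X : nat) (vs : seq (expr Val)) (cs : seq chan)
| PNil
| PPar (P Q : proc R Val).

Arguments PCall {R Val}.
Arguments PNil {R Val}.

Fixpoint wf_proc (R : realFieldType) (Val : Type) (P : proc R Val) : bool :=
  match P with
  | PSelect _ _ bs =>
      [&& (0 < size bs)%N, uniq [seq slab b | b <- bs]
        & all (fun b => wf_proc (scont b)) bs]
  | PBranch _ _ bs =>
      [&& (0 < size bs)%N, uniq [seq b.1 | b <- bs]
        & all (fun b => wf_proc b.2) bs]
  | PRes P' => wf_proc P'
  | PDef _ _ P' Q => wf_proc P' && wf_proc Q
  | PCall _ _ _ | PNil => true
  | PPar P' Q => wf_proc P' && wf_proc Q
  end.

(** * Sortings and typings *)

(* The i-th entry of svars is the sort of the base variable of index i, the i-th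
   entry of spvars the sorts and types of the parameters of the process
   variable of index i. *)
Record sorting (Sort A : Type) : Type :=
  Sorting { svars : seq Sort; spvars : seq (seq Sort * seq (ltype Sort A)) }.

(* Typings assign types to channels c ::= x | s[r], since the typing rules
   use both kinds. *)
Definition typing (Sort A : Type) : Type := {fmap chan -> ltype Sort A}.

Definition wf_sorting (Sort A : Type) (Gam : sorting Sort A) : bool :=
  all (fun e => all (@wf_ltype Sort A) e.2) (spvars Gam).

Definition wf_typing (Sort A : Type) (Del : typing Sort A) : Prop :=
  forall c T, Del.[? c] = Some T -> wf_ltype T.

Definition end_only (Sort A : Type) (Del : typing Sort A) : Prop :=
  forall c T, Del.[? c] = Some T -> T = LEnd.

Definition serase (Sort A : Type) (Gam : sorting Sort A) : sorting Sort unit :=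
  Sorting (svars Gam)
          [seq (e.1, [seq lerase T | T <- e.2]) | e <- spvars Gam].

Definition terase (Sort A : Type) (Del : typing Sort A) : typing Sort unit :=
  [fmap c : domf Del => lerase (Del c)].

Definition scap (R : realFieldType) (Sort : eqType)
    (Gam1 Gam2 : sorting Sort (impr R)) : option (sorting Sort (impr R)) :=
  if svars Gam1 == svars Gam2 then
    omap (Sorting (svars Gam1)) (ozip (fun e1 e2 =>
      if e1.1 == e2.1 then omap (pair e1.1) (ozip (@lcap R Sort) e1.2 e2.2)
      else None) (spvars Gam1) (spvars Gam2))
  else None.

Definition lcap_at (R : realFieldType) (Sort : eqType)
    (Del1 Del2 : typing Sort (impr R)) (c : chan) :
    option (ltype Sort (impr R)) :=
  match Del1.[? c], Del2.[? c] with
  | Some T1, Some T2 => lcap T1 T2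
  | _, _ => None
  end.

(* Undefined as soon as T1 /\ T2 is undefined at some common channel (reducef
   only strips the option constructor here). *)
Definition tcap (R : realFieldType) (Sort : eqType)
    (Del1 Del2 : typing Sort (impr R)) : option (typing Sort (impr R)) :=
  let D := domf Del1 `&` domf Del2 in
  if all (fun c => isSome (lcap_at Del1 Del2 c)) D then
    Some (reducef [fmap c : D => lcap_at Del1 Del2 (val c)])
  else None.

(* The typing c_1 : T_1, ..., c_n : T_n. *)
Definition bindings (Sort A : Type) (cs : seq chan) (Ts : seq (ltype Sort A)) :
  typing Sort A := foldr (fun cT Del => Del.[cT.1 <- cT.2]) [fmap] (zip cs Ts).

(* A typing seen from below a restriction. *)
Definition typing_up (Sort A : Type) (Del : typing Sort A) : typing Sort A :=
  reducef [fmap c : [fset chan_up c | c in domf Del]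
             => Del.[? chan_down (val c)]].

Lemma typing_upE (Sort A : Type) (Del : typing Sort A) (c : chan) :
  (typing_up Del).[? chan_up c] = Del.[? c].
Proof.
rewrite /typing_up fnd_reducef.
case: fndP => [cD|]; first by rewrite ffunE /= chan_upK.
move=> cD /=; rewrite not_fnd //; apply: contra cD => cD.
by apply/imfsetP; exists c.
Qed.

(** * Typing rules *)

Section Rules.
Variables (R : realFieldType) (Sort Val : Type).
(* [vsort v S] : S is a sort of the base value v. *)
Variable vsort : Val -> Sort -> Prop.

Local Notation sorting := (sorting Sort (impr R)).
Local Notation typing := (typing Sort (impr R)).
Local Notation ltype := (ltype Sort (impr R)).
Local Notation gtype := (gtype Sort (impr R)).
Local Notation proc := (proc R Val).

Inductive has_sort (Gam : sorting) : expr Val -> Sort -> Prop :=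
| TVar x S : onth (svars Gam) x = Some S -> has_sort Gam (EVar x) S
| TVal v S : vsort v S -> has_sort Gam (EVal v) S.

(* Disjointness of the domains in  Del, Del'  is an explicit premise of each
   rule.  Types that a rule introduces without reading them off the process or
   the sorting (TRes, TDef) are required to be well formed. *)
Inductive typed : sorting -> proc -> typing -> Prop :=
| TSelect Gam Del c r (bs : seq (sbranch R Val proc))
    (ts : seq (branch Sort (impr R) ltype)) :
    c \notin domf Del ->
    [seq slab b | b <- bs] = [seq lab t | t <- ts] ->
    (forall i b t, onth bs i = Some b -> onth ts i = Some t ->
       has_sort Gam (sval b) (srt t)) ->
    (forall i b t, onth bs i = Some b -> onth ts i = Some t ->
       typed Gam (scont b) Del.[c <- cont t]) ->
    \sum_(b <- bs) val (sprob b) = 1 ->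
    (forall i b t, onth bs i = Some b -> onth ts i = Some t ->
       in_impr (sprob b) (ann t)) ->
    typed Gam (PSelect c r bs) Del.[c <- LSelect r ts]
| TBranch Gam Del c r (bs : seq (label * proc))
    (ts : seq (branch Sort unit ltype)) :
    c \notin domf Del ->
    [seq b.1 | b <- bs] = [seq lab t | t <- ts] ->
    (forall i b t, onth bs i = Some b -> onth ts i = Some t ->
       typed (Sorting (srt t :: svars Gam) (spvars Gam)) b.2
             Del.[c <- cont t]) ->
    typed Gam (PBranch c r bs) Del.[c <- LBranch r ts]
| TEnd Gam Del :
    end_only Del ->
    typed Gam PNil Del
| TConc Gam Del Del' P Q :
    [disjoint domf Del & domf Del'] ->
    typed Gam P Del ->
    typed Gam Q Del' ->
    typed Gam (PPar P Q) (Del + Del')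
| TRes Gam Del P (G : gtype) (rs : seq role) (Ts : seq ltype) :
    wf_gtype G ->
    uniq rs ->
    size (undup (participants G)) = size rs ->
    size Ts = size rs ->
    (forall i r T, onth rs i = Some r -> onth Ts i = Some T -> proj G r T) ->
    typed Gam P (typing_up Del + bindings [seq CSess 0 r | r <- rs] Ts) ->
    typed Gam (PRes P) Del
| TDef Gam Del P Q (Ss : seq Sort) (Ts : seq ltype) :
    all (@wf_ltype Sort (impr R)) Ts ->
    typed (Sorting (Ss ++ svars Gam) ((Ss, Ts) :: spvars Gam)) P
          (bindings [seq CVar j | j <- iota 0 (size Ts)] Ts) ->
    typed (Sorting (svars Gam) ((Ss, Ts) :: spvars Gam)) Q Del ->
    typed Gam (PDef (size Ss) (size Ts) P Q) Del
| TCall Gam Del X vs cs (Ss : seq Sort) (Ts : seq ltype) :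
    onth (spvars Gam) X = Some (Ss, Ts) ->
    size vs = size Ss ->
    (forall i v S, onth vs i = Some v -> onth Ss i = Some S ->
       has_sort Gam v S) ->
    end_only Del ->
    size cs = size Ts ->
    uniq cs ->
    [disjoint domf Del & [fset c in cs]] ->
    typed Gam (PCall X vs cs) (Del + bindings cs Ts).

End Rules.

(* Main.v *)
(* Intersection extends to a total operation [lmix T1 T2] on types of arbitrary
   shapes: keep the structure and the sorts of T1 and intersect annotations only
   at the positions that both types have.  Types hidden in the two derivations
   (the parameters of a definition, the endpoints of a restricted session) may
   have different shapes, so their intersection may be undefined, but they can
   always be mixed.  Every typing rule only equates types, so mixing the two
   derivations pointwise yields a derivation.  The rule for restriction needs a
   global type for the mixed endpoints: the annotations of a global type occur
   only in the projections on the senders, hence any re-annotation of its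
   projections is realized by a re-annotation of the global type. *)
Require Import Defs.
From HB Require Import structures.
From mathcomp Require Import all_boot all_order all_algebra.
From mathcomp Require Import finmap.

Import Order.TTheory.

Local Open Scope ring_scope.
Local Open Scope fset_scope.
Local Open Scope fmap_scope.

Set Implicit Arguments.
Unset Strict Implicit.

(** * Lists *)

Lemma all_onth (T : Type) (p : pred T) (s : seq T) (i : nat) (x : T) :
  all p s -> onth s i = Some x -> p x.
Proof.
elim: s i => [|y s IH] [|i] //= /andP[py ps]; first by case=> <-.
exact: IH.
Qed.

Lemma eq_map_onth (T U V : Type) (f : T -> V) (g : U -> V) s t i x y :
  map f s = map g t -> onth s i = Some x -> onth t i = Some y -> f x = g y.
Proof.
move=> /(congr1 (fun u => onth u i)); rewrite !onth_map => + sx ty.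
by rewrite sx ty => -[].
Qed.

Lemma eq_onth_map (T U V : Type) (f : T -> V) (g : U -> V) s t :
  size s = size t ->
  (forall i x y, onth s i = Some x -> onth t i = Some y -> f x = g y) ->
  map f s = map g t.
Proof.
elim: s t => [|x s IH] [|y t] //= [st] fg.
by rewrite (fg 0%N x y) // (IH t) // => i; apply: (fg i.+1).
Qed.

Lemma onth_size (T U : Type) (s : seq T) (t : seq U) i x :
  size s = size t -> onth s i = Some x -> exists y, onth t i = Some y.
Proof.
move=> st sx; have : isSome (onth t i) by rewrite onthTE -st -onthTE sx.
by case: (onth t i) => // y _; exists y.
Qed.

Lemma onth_zip (T U : Type) (s : seq T) (t : seq U) i x :
  size t = size s -> onth (zip s t) i = Some x ->
  onth s i = Some x.1 /\ onth t i = Some x.2.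
Proof.
elim: s t i => [|y s IH] [|z t] [|i] //= []; first by move=> _ [<-].
exact: IH.
Qed.

Lemma onth_lt (T : Type) (x0 : T) (s : seq T) (i : nat) :
  (i < size s)%N -> onth s i = Some (nth x0 s i).
Proof. by elim: s i => [|x s IH] [|i] //=; apply: IH. Qed.

(** Recursion on the list takes the place of a choice axiom: witnesses found position by position
    are collected into one list. It serves to assemble the alternatives of a re-annotated global
    type. *)
Lemma onth_choice (T U : Type) (Q : nat -> T -> U -> Prop) (s : seq T) :
  (forall i x, onth s i = Some x -> exists y, Q i x y) ->
  exists2 t, size t = size s
    & forall i x y, onth s i = Some x -> onth t i = Some y -> Q i x y.
Proof.
elim: s Q => [|x s IH] Q Qex; first by exists [::] => // -[].
have [y Qy] := Qex 0%N x erefl.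
have [t st Qt] := IH (fun i => Q i.+1) (fun i => Qex i.+1).
exists (y :: t) => [|[|i] x' y' /=]; first by rewrite /= st.
  by move=> [<-] [<-].
exact: Qt.
Qed.

(** Surplus elements of [s] are kept, so the length of [s] survives whatever [t] is; this makes
    mixing total and lets it preserve the shape of its first argument. *)
Fixpoint zipw (A B : Type) (f : A -> B -> A) (s : seq A) (t : seq B) : seq A :=
  match s, t with
  | a :: s', b :: t' => f a b :: zipw f s' t'
  | _, _ => s
  end.

Lemma size_zipw (A B : Type) (f : A -> B -> A) s t : size (zipw f s t) = size s.
Proof. by elim: s t => [|a s IH] [|b t] //=; rewrite IH. Qed.

Lemma map_zipw (A B C : Type) (f : A -> B -> A) (g : A -> C) s t :
  (forall i a b, onth s i = Some a -> g (f a b) = g a) ->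
  map g (zipw f s t) = map g s.
Proof.
elim: s t => [|a s IH] [|b t] //= gf.
by rewrite (gf 0%N) // IH // => i a' b'; apply: (gf i.+1).
Qed.

Lemma onth_zipw (A B : Type) (f : A -> B -> A) s t i a b :
  onth s i = Some a -> onth t i = Some b -> onth (zipw f s t) i = Some (f a b).
Proof.
elim: s t i => [|a' s IH] [|b' t] [|i] //=; first by move=> [<-] [<-].
exact: IH.
Qed.

Lemma onth_zipw_inv (A B : Type) (f : A -> B -> A) s t i c :
  size s = size t -> onth (zipw f s t) i = Some c ->
  exists a b, [/\ onth s i = Some a, onth t i = Some b & c = f a b].
Proof.
elim: s t i => [|a s IH] [|b t] [|i] //=; first by move=> _ [<-]; exists a, b.
by case; apply: IH.
Qed.

(** * Structural induction on types *)

(** The automatically generated principle gives no hypothesis for types nested in lists of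
    alternatives. Positions are expressed by [onth], as in the projection and typing rules. *)
Lemma ltype_nested_ind (Sort A : Type) (Q : ltype Sort A -> Prop) :
  (forall r bs, (forall i b, onth bs i = Some b -> Q (cont b)) ->
     Q (LSelect r bs)) ->
  (forall r bs, (forall i b, onth bs i = Some b -> Q (cont b)) ->
     Q (LBranch r bs)) ->
  (forall T, Q T -> Q (LMu T)) ->
  (forall t, Q (LVar t)) -> Q LEnd -> forall T, Q T.
Proof.
move=> QS QB QM QV QE; fix IH 1; case=> [r bs|r bs|T|t|].
(* [discriminate] and not [by []], which would apply [IH] to an unguarded term. *)
- apply: QS; elim: bs => [|b bs IHbs] [|i] b' /=.
  + discriminate.
  + discriminate.
  + case=> <-; exact: IH.
  + exact: IHbs.
- apply: QB; elim: bs => [|b bs IHbs] [|i] b' /=.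
  + discriminate.
  + discriminate.
  + case=> <-; exact: IH.
  + exact: IHbs.
- exact/QM/IH.
- exact: QV.
- exact: QE.
Qed.

Lemma gtype_nested_ind (Sort A : Type) (Q : gtype Sort A -> Prop) :
  (forall r1 r2 bs, (forall i b, onth bs i = Some b -> Q (cont b)) ->
     Q (GComm r1 r2 bs)) ->
  (forall G, Q G -> Q (GMu G)) ->
  (forall t, Q (GVar t)) -> Q GEnd -> forall G, Q G.
Proof.
move=> QC QM QV QE; fix IH 1; case=> [r1 r2 bs|G|t|].
- apply: QC; elim: bs => [|b bs IHbs] [|i] b' /=.
  + discriminate.
  + discriminate.
  + case=> <-; exact: IH.
  + exact: IHbs.
- exact/QM/IH.
- exact: QV.
- exact: QE.
Qed.

(** * Mixing types *)

Definition impr_mix (R : realFieldType) (d1 d2 : impr R) : impr R :=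
  odflt d1 (impr_cap d1 d2).

(** If the intersection is undefined, the mix is its default [d1], which contains [p] by assumption;
    otherwise [p] meets both pairs of bounds. *)
Lemma in_impr_mix (R : realFieldType) (p : prob R) (d1 d2 : impr R) :
  in_impr p d1 -> in_impr p d2 -> in_impr p (impr_mix d1 d2).
Proof.
move=> pd1 pd2; rewrite /impr_mix /impr_cap; case: insubP => //= d _ dE.
case/andP: pd1 => p1 p1'; case/andP: pd2 => p2 p2'.
by rewrite /in_impr [val d]dE /= ge_max le_min p1 p1' p2 p2'.
Qed.

Fixpoint lmix (R : realFieldType) (Sort : Type)
    (T1 T2 : ltype Sort (impr R)) : ltype Sort (impr R) :=
  match T1, T2 with
  | LSelect r bs1, LSelect _ bs2 =>
      LSelect r (zipw (fun b1 b2 =>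
        Branch (impr_mix (ann b1) (ann b2)) (lab b1) (srt b1)
               (lmix (cont b1) (cont b2))) bs1 bs2)
  | LBranch r bs1, LBranch _ bs2 =>
      LBranch r (zipw (fun b1 b2 =>
        Branch tt (lab b1) (srt b1) (lmix (cont b1) (cont b2))) bs1 bs2)
  | LMu T1', LMu T2' => LMu (lmix T1' T2')
  | _, _ => T1
  end.

(** Whatever depends only on the erasure passes from [T1] to the mix: well-formedness, and being a
    re-annotation of a projection. *)
Lemma lerase_lmix (R : realFieldType) (Sort : Type)
    (T1 T2 : ltype Sort (impr R)) : lerase (lmix T1 T2) = lerase T1.
Proof.
elim/ltype_nested_ind: T1 T2 => [r bs IH|r bs IH|T IH|t|] [r' bs'|r' bs'|T'|t'|] //=.
- by congr (LSelect _ _); apply: map_zipw => i b b' /IH E; rewrite /with_ann /= E.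
- by congr (LBranch _ _); apply: map_zipw => i [[] l S T] b' /IH E; rewrite /with_cont /= E.
- by rewrite IH.
Qed.

Lemma wf_lerase (Sort A : Type) (T : ltype Sort A) :
  wf_ltype (lerase T) = wf_ltype T.
Proof.
elim/ltype_nested_ind: T => [r bs IH|r bs IH|T IH|t|] //=.
- rewrite size_map -map_comp all_map; congr [&& _, _ & _].
  elim: bs IH => //= b bs IHbs IH; rewrite (IH 0%N) // IHbs // => i.
  exact: (IH i.+1).
- rewrite size_map -map_comp all_map; congr [&& _, _ & _].
  elim: bs IH => //= b bs IHbs IH; rewrite (IH 0%N) // IHbs // => i.
  exact: (IH i.+1).
Qed.

Lemma wf_lmix (R : realFieldType) (Sort : Type) (T1 T2 : ltype Sort (impr R)) :
  wf_ltype (lmix T1 T2) = wf_ltype T1.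
Proof. by rewrite -wf_lerase lerase_lmix wf_lerase. Qed.

(** [ozip] succeeds only on lists of equal length, so there is no surplus for [zipw] to keep. *)
Lemma ozip_zipw (A B : Type) (f : A -> B -> option A) (g : A -> B -> A) s t u :
  (forall i a b c, onth s i = Some a -> f a b = Some c -> g a b = c) ->
  ozip f s t = Some u -> zipw g s t = u.
Proof.
elim: s t u => [|a s IH] [|b t] u //= fg; first by case.
case fab: (f a b) => [c|] //; case E: (ozip f s t) => [v|] // [<-].
rewrite (fg 0%N a b c) //; congr cons; apply: IH E => i.
exact: (fg i.+1).
Qed.

(** A defined intersection never meets a fallback of [lmix]: constructors and lengths match and the
    intervals overlap. This is the way back from mixes to intersections. *)
Lemma lcap_lmix (R : realFieldType) (Sort : eqType)
    (T1 T2 T : ltype Sort (impr R)) : lcap T1 T2 = Some T -> lmix T1 T2 = T.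
Proof.
elim/ltype_nested_ind: T1 T2 T
  => [r bs IH|r bs IH|T1 IH|t|] [r' bs'|r' bs'|T2|t'|] T //=.
- case: eqP => // _; case E: ozip => [u|] // [<-]; congr LSelect.
  apply: ozip_zipw E => i b1 b2 b /IH{}IH; case: ifP => // _.
  rewrite /impr_mix; case: impr_cap => // d.
  by case E: lcap => [T'|] // [<-]; rewrite (IH _ _ E).
- case: eqP => // _; case E: ozip => [u|] // [<-]; congr LBranch.
  apply: ozip_zipw E => i b1 b2 b /IH{}IH; case: ifP => // _.
  by case E: lcap => [T'|] // [<-]; rewrite (IH _ _ E).
- by case E: lcap => [T'|] // [<-]; rewrite (IH _ _ E).
- by case: ifP => // _ [].
- by case.
Qed.

(** * Mixing sortings and typings *)

Definition smix (R : realFieldType) (Sort : Type)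
    (Gam1 Gam2 : sorting Sort (impr R)) : sorting Sort (impr R) :=
  Sorting (svars Gam1)
    (zipw (fun e1 e2 => (e1.1, zipw (@lmix R Sort) e1.2 e2.2))
       (spvars Gam1) (spvars Gam2)).

Lemma scap_smix (R : realFieldType) (Sort : eqType)
    (Gam1 Gam2 Gam : sorting Sort (impr R)) :
  scap Gam1 Gam2 = Some Gam -> smix Gam1 Gam2 = Gam.
Proof.
rewrite /scap; case: ifP => // _; case E: ozip => [u|] // [<-].
rewrite /smix; congr Sorting; apply: ozip_zipw E => i e1 e2 e _.
case: ifP => // _; case E: ozip => [v|] // [<-]; congr pair.
by apply: ozip_zipw E => j T1 T2 T _; apply: lcap_lmix.
Qed.

(** The domain is that of [Del1], not the common one: inside two derivations the typings may have
    different domains, since a restricted session may get other participants and end-typed channels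
    may be distributed differently. *)
Definition tmix (R : realFieldType) (Sort : Type)
    (Del1 Del2 : typing Sort (impr R)) : typing Sort (impr R) :=
  [fmap c : domf Del1 => oapp (lmix (Del1 c)) (Del1 c) Del2.[? val c]].

Lemma fnd_tmix (R : realFieldType) (Sort : Type)
    (Del1 Del2 : typing Sort (impr R)) (c : chan) :
  (tmix Del1 Del2).[? c] =
  omap (fun T1 => oapp (lmix T1) T1 Del2.[? c]) Del1.[? c].
Proof.
case: (fndP Del1 c) => [cD|cD]; last by rewrite not_fnd.
by rewrite (in_fnd (cD : c \in domf (tmix Del1 Del2))) ffunE.
Qed.

Lemma fnd_domf (Sort A : Type) (Del : typing Sort A) (c : chan) :
  (c \in domf Del) = isSome Del.[? c].
Proof. by case: fndP. Qed.

Lemma tcap_tmix (R : realFieldType) (Sort : eqType)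
    (Del1 Del2 Del : typing Sort (impr R)) :
  domf Del1 = domf Del2 -> tcap Del1 Del2 = Some Del -> tmix Del1 Del2 = Del.
Proof.
move=> dom12; rewrite /tcap; case: ifP => // /allP capD [<-].
apply/fmapP => c; rewrite fnd_tmix fnd_reducef.
set D := domf Del1 `&` domf Del2.
case: (fndP [fmap k : D => lcap_at Del1 Del2 (val k)] c) => [cD|] /=.
  move: (capD c cD); rewrite ffunE /= /lcap_at.
  case: Del1.[? c] => [T1|] //; case: Del2.[? c] => [T2|] //=.
  by case E: lcap => [T|] // _; rewrite (lcap_lmix E).
move=> cD; case: (fndP Del1 c) => // cD1; case/negP: cD.
by rewrite in_fsetI -dom12 andbb.
Qed.

Lemma tmix_set (R : realFieldType) (Sort : Type)
    (Del1 Del2 : typing Sort (impr R)) (c : chan) T1 T2 :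
  tmix Del1.[c <- T1] Del2.[c <- T2] = (tmix Del1 Del2).[c <- lmix T1 T2].
Proof.
apply/fmapP => k; rewrite fnd_tmix !fnd_set fnd_tmix.
by case: eqP.
Qed.

(** Lists of different lengths are harmless: where [Ts2] runs out, both sides keep the entries of
    [Ts1], and where [cs] or [Ts1] runs out, both sides stop. *)
Lemma tmix_bindings (R : realFieldType) (Sort : Type) (cs : seq chan)
    (Ts1 Ts2 : seq (ltype Sort (impr R))) :
  tmix (bindings cs Ts1) (bindings cs Ts2) =
  bindings cs (zipw (@lmix R Sort) Ts1 Ts2).
Proof.
have tmix0 (Del : typing Sort (impr R)) : tmix Del [fmap] = Del.
  by apply/fmapP => k; rewrite fnd_tmix fnd_fmap0; case: fnd.
have t0mix (Del : typing Sort (impr R)) : tmix [fmap] Del = [fmap].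
  by apply/fmapP => k; rewrite fnd_tmix fnd_fmap0.
elim: cs Ts1 Ts2 => [|c cs IH] [|T1 Ts1] [|T2 Ts2];
  rewrite /bindings /= ?tmix0 ?t0mix //.
by rewrite tmix_set IH.
Qed.

(** * Re-annotating global types *)

Definition select_branches (Sort A : Type) (T : ltype Sort A) :=
  if T is LSelect _ bs then bs else [::].

(** Applied to the projection of a communication on its sender or receiver, this recovers the
    projection of the continuation at position [i]; [LEnd] is a dummy value. *)
Definition lcont (Sort A : Type) (i : nat) (T : ltype Sort A) : ltype Sort A :=
  match T with
  | LSelect _ bs => oapp (@cont _ _ _) LEnd (onth bs i)
  | LBranch _ bs => oapp (@cont _ _ _) LEnd (onth bs i)
  | _ => LEnd
  end.

(** Here the default matters: a recursion whose body projects to [LEnd] itself projects to [LEnd],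
    so the projection of the body is recovered under both projection rules for recursion. *)
Definition lunmu (Sort A : Type) (T : ltype Sort A) : ltype Sort A :=
  if T is LMu T' then T' else LEnd.

Lemma lerase_lcont (Sort A : Type) (i : nat) (T T' : ltype Sort A) :
  lerase T' = lerase T -> lerase (lcont i T') = lerase (lcont i T).
Proof.
case: T T' => [r bs|r bs|T|t|] [r' bs'|r' bs'|T'|t'|] //= [_].
- move/(congr1 (fun s => onth s i)); rewrite !onth_map.
  by case: (onth bs i) (onth bs' i) => [b|] [b'|] //= [].
- move/(congr1 (fun s => onth s i)); rewrite !onth_map.
  by case: (onth bs i) (onth bs' i) => [b|] [b'|] //= [].
Qed.

Lemma lerase_lunmu (Sort A : Type) (T T' : ltype Sort A) :
  lerase T' = lerase T -> lerase (lunmu T') = lerase (lunmu T).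
Proof. by case: T T' => [r bs|r bs|T|t|] [r' bs'|r' bs'|T'|t'|] //= []. Qed.

(** The projection rules for communications in positional form, without zipped lists, usable both to
    invert and to build a projection. Only the sender case constrains annotations. *)
Variant proj_comm_spec (Sort A : Type) (r1 r2 : role)
    (bs : seq (branch Sort A (gtype Sort A))) (r : role) : ltype Sort A -> Prop :=
| ProjSender ts of r = r1 & r1 <> r2 & size ts = size bs &
    (forall i b t, onth bs i = Some b -> onth ts i = Some t ->
       [/\ ann t = ann b, lab t = lab b, srt t = srt b
         & proj (cont b) r (cont t)]) :
    proj_comm_spec r1 r2 bs r (LSelect r ts)
| ProjReceiver ts of r = r2 & r1 <> r2 & size ts = size bs &
    (forall i b t, onth bs i = Some b -> onth ts i = Some t ->
       [/\ lab t = lab b, srt t = srt b & proj (cont b) r (cont t)]) :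
    proj_comm_spec r1 r2 bs r (LBranch r ts)
| ProjOther T of r <> r1 & r <> r2 & (0 < size bs)%N &
    (forall i b, onth bs i = Some b -> proj (cont b) r T) :
    proj_comm_spec r1 r2 bs r T.

Lemma proj_commP (Sort A : Type) (r1 r2 r : role)
    (bs : seq (branch Sort A (gtype Sort A))) (T : ltype Sort A) :
  proj (GComm r1 r2 bs) r T <-> proj_comm_spec r1 r2 bs r T.
Proof.
split=> [prj|].
  inversion prj as [? ? ? Ts ne12 szTs TsP|? ? ? Ts ne12 szTs TsP| | | | |]; subst.
  - apply: ProjSender => // [|i b t bi]; first by rewrite size_map size1_zip ?szTs.
    rewrite onth_map; case E: (onth (zip _ _) i) => [[b' U]|] //= [<-].
    have [] := onth_zip szTs E; rewrite bi => -[<-] Ui.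
    by split=> //=; apply: TsP Ui.
  - apply: ProjReceiver => // [|i b t bi]; first by rewrite size_map size1_zip ?szTs.
    rewrite onth_map; case E: (onth (zip _ _) i) => [[b' U]|] //= [<-].
    have [] := onth_zip szTs E; rewrite bi => -[<-] Ui.
    by split=> //=; apply: TsP Ui.
  - exact: ProjOther.
case=> [ts -> ne12 sz tsP|ts -> ne12 sz tsP|{}T ne1 ne2 bs_gt0 TP].
- have -> : ts = [seq with_cont bT.2 bT.1 | bT <- zip bs [seq cont t | t <- ts]].
    elim: ts bs sz tsP => [|t ts IH] [|b bs] //= [sz] tsP.
    rewrite -IH => // [|i]; last exact: (tsP i.+1).
    have [] := tsP 0%N b t erefl erefl.
    by case: t {tsP} => a l S U /= -> -> -> _.
  apply: proj_sender => //; first by rewrite size_map.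
  move=> i b U bi; rewrite onth_map; case E: (onth ts i) => [t|] //= [<-].
  by case: (tsP i b t).
- have -> : ts = [seq with_ann tt (with_cont bT.2 bT.1)
                 | bT <- zip bs [seq cont t | t <- ts]].
    elim: ts bs sz tsP => [|t ts IH] [|b bs] //= [sz] tsP.
    rewrite -IH => // [|i]; last exact: (tsP i.+1).
    have [] := tsP 0%N b t erefl erefl.
    by case: t {tsP} => -[] l S U /= -> -> _.
  apply: proj_receiver => //; first by rewrite size_map.
  move=> i b U bi; rewrite onth_map; case E: (onth ts i) => [t|] //= [<-].
  by case: (tsP i b t).
- exact: proj_other.
Qed.

(** All roles are treated at once because one [G'] must serve them all. No conflict can arise: each
    annotation of a global type is visible only to the sender of its communication, so it can be
    copied from that sender's new type. *)
Lemma proj_reannotate (Sort A : Type) (rs : pred role) (G : gtype Sort A)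
    (T T' : role -> ltype Sort A) :
  (forall r, rs r -> proj G r (T r)) ->
  (forall r, rs r -> lerase (T' r) = lerase (T r)) ->
  exists G', [/\ wf_gtype G' = wf_gtype G, participants G' = participants G
    & forall r, rs r -> proj G' r (T' r)].
Proof.
elim/gtype_nested_ind: G T T' => [r1 r2 bs IH|G IH|t|] T T' projT eraseT.
(* Sender and receiver move past the prefix; any other role has the same projection in all
   alternatives and keeps its whole type. *)
- pose cont_at i (T : role -> ltype Sort A) r :=
    if (r == r1) || (r == r2) then lcont i (T r) else T r.
  have [bs' size_bs' bs'P] : exists2 bs', size bs' = size bs &
      forall i b b', onth bs i = Some b -> onth bs' i = Some b' ->
        [/\ lab b' = lab b, srt b' = srt b,
            forall t, rs r1 -> onth (select_branches (T' r1)) i = Some t ->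
              ann t = ann b'
          & [/\ wf_gtype (cont b') = wf_gtype (cont b),
                participants (cont b') = participants (cont b)
              & forall r, rs r -> proj (cont b') r (cont_at i T' r)]].
    apply: onth_choice => i b bi.
    have [r rsr|r rsr|G' G'P] := IH i b bi (cont_at i T) (cont_at i T').
    + rewrite /cont_at; case/proj_commP: (projT r rsr).
      * move=> ts -> _ sz tsP; rewrite eqxx /=.
        have [t ti] := onth_size (esym sz) bi.
        by rewrite ti; case: (tsP i b t).
      * move=> ts -> _ sz tsP; rewrite eqxx orbT /=.
        have [t ti] := onth_size (esym sz) bi.
        by rewrite ti; case: (tsP i b t).
      * by move=> U /eqP/negPf -> /eqP/negPf -> _ UP; apply: UP bi.
    + rewrite /cont_at; case: ifP => _; last exact: eraseT.
      exact/lerase_lcont/eraseT.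
    (* The annotation is read off the new type of the sender; the old one remains if that type has
       no selection alternative at [i]. *)
    exists (Branch (oapp (@ann _ _ _) (ann b)
                      (onth (select_branches (T' r1)) i)) (lab b) (srt b) G').
    by split=> //= t _ ->.
  have labs : map (@lab _ _ _) bs' = map (@lab _ _ _) bs.
    by apply: eq_onth_map => // i b' b b'i bi; case: (bs'P i b b').
  have wfs : [seq wf_gtype (cont b) | b <- bs'] = [seq wf_gtype (cont b) | b <- bs].
    by apply: eq_onth_map => // i b' b b'i bi; case: (bs'P i b b') => // _ _ _ [].
  have parts : [seq participants (cont b) | b <- bs']
             = [seq participants (cont b) | b <- bs].
    by apply: eq_onth_map => // i b' b b'i bi; case: (bs'P i b b') => // _ _ _ [].
  exists (GComm r1 r2 bs'); split.
  + rewrite /= size_bs' labs; congr [&& _, _ & _].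
    by have /(congr1 (all id)) := wfs; rewrite !all_map.
  + by rewrite /= parts.
  move=> r rsr; apply/proj_commP; have := eraseT r rsr.
  case/proj_commP: (projT r rsr).
  + move=> ts rE ne12 sz tsP; case E: (T' r) => [r' ts'||||] //= [-> ets].
    apply: ProjSender => //.
      by have /(congr1 size) := ets; rewrite !size_map size_bs' sz.
    move=> i b' t' b'i t'i; have [b bi] := onth_size size_bs' b'i.
    have [t ti] := onth_size (esym sz) bi.
    have [lab_t srt_t] : lab t' = lab t /\ srt t' = srt t.
      by have [] := eq_map_onth ets t'i ti.
    have [_ lab_b srt_b _] := tsP i b t bi ti.
    have [lab_b' srt_b' ann_b' [_ _ prj]] := bs'P i b b' bi b'i.
    split; first by apply: ann_b'; rewrite -rE ?E.
    * by rewrite lab_b' lab_t lab_b.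
    * by rewrite srt_b' srt_t srt_b.
    * by have := prj r rsr; rewrite /cont_at rE eqxx -rE E /= t'i.
  + move=> ts rE ne12 sz tsP; case E: (T' r) => [|r' ts'|||] //= [-> ets].
    apply: ProjReceiver => //.
      by have /(congr1 size) := ets; rewrite !size_map size_bs' sz.
    move=> i b' t' b'i t'i; have [b bi] := onth_size size_bs' b'i.
    have [t ti] := onth_size (esym sz) bi.
    have [lab_t srt_t] : lab t' = lab t /\ srt t' = srt t.
      by have [] := eq_map_onth ets t'i ti.
    have [lab_b srt_b _] := tsP i b t bi ti.
    have [lab_b' srt_b' _ [_ _ prj]] := bs'P i b b' bi b'i.
    split.
    * by rewrite lab_b' lab_t lab_b.
    * by rewrite srt_b' srt_t srt_b.
    * by have := prj r rsr; rewrite /cont_at rE eqxx orbT -rE E /= t'i.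
  + move=> U ne1 ne2 bs_gt0 _ _; apply: ProjOther => //; first by rewrite size_bs'.
    move=> i b' b'i; have [b bi] := onth_size size_bs' b'i.
    have [_ _ _ [_ _ /(_ r rsr)]] := bs'P i b b' bi b'i.
    by rewrite /cont_at; move/eqP/negPf: ne1 => ->; move/eqP/negPf: ne2 => ->.
- have [r rsr|r rsr|G' [wfG' partG' projG']] := IH (fun r => lunmu (T r)) (fun r => lunmu (T' r)).
  + have := projT r rsr; move: (T r) => U prj.
    by inversion prj.
  + exact/lerase_lunmu/eraseT.
  exists (GMu G'); split=> // r rsr.
  have := eraseT r rsr; have := projG' r rsr; have := projT r rsr.
  move: (T r) (T' r) => U U' prj.
  inversion prj as [| | |G0 r0 U0 _ U0N|G0 r0 _| |] => /=; subst.
  (* The side condition of the recursion rule survives re-annotation, since only [LEnd] erases to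
     [LEnd]. *)
  + case: U' => //= U' pU' [eU']; apply: proj_mu => // U'E.
    by move: eU'; rewrite U'E; case: (U0) U0N.
  + by case: U' => //= pU' _; apply: proj_mu_end.
- exists (GVar t); split=> // r rsr; have := eraseT r rsr; have := projT r rsr.
  move: (T r) (T' r) => U U' prj.
  inversion prj; subst; case: U' => //= _ [->]; apply: proj_var.
- exists GEnd; split=> // r rsr; have := eraseT r rsr; have := projT r rsr.
  move: (T r) (T' r) => U U' prj.
  inversion prj; subst; case: U' => //= _; apply: proj_end.
Qed.

(** * Mixing derivations *)

Lemma typing_up0 (Sort A : Type) (Del : typing Sort A) (r : role) :
  (typing_up Del).[? CSess 0 r] = None.
Proof.
rewrite /typing_up fnd_reducef; case: fndP => // cD.
by have /imfsetP[[x|s r'] _] := cD.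
Qed.

(** Below a restriction a channel is either a renamed outer channel or an endpoint of the new
    session, and lookups behave differently in the two cases. *)
Lemma chan_up_ind (Q : chan -> Prop) :
  (forall c, Q (chan_up c)) -> (forall r, Q (CSess 0 r)) -> forall c, Q c.
Proof.
move=> Qup Q0 [x|[|s] r] //; first exact: (Qup (CVar x)).
exact: (Qup (CSess s r)).
Qed.

Lemma domf_bindings (Sort A : Type) (cs : seq chan) (Ts : seq (ltype Sort A))
    (c : chan) :
  size cs = size Ts -> (c \in domf (bindings cs Ts)) = (c \in cs).
Proof.
elim: cs Ts => [|c' cs IH] [|T Ts] //= [sz].
by rewrite /bindings /= in_fset1U in_cons (IH Ts sz).
Qed.

(** The function sees the channel, so the endpoints of a restricted session can be mixed by role
    instead of by position in the list of roles. *)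
Lemma bindings_zip_map (Sort A : Type) (g : chan -> ltype Sort A -> ltype Sort A)
    (cs : seq chan) (Ts : seq (ltype Sort A)) (c : chan) :
  (bindings cs [seq g cT.1 cT.2 | cT <- zip cs Ts]).[? c] =
  omap (g c) (bindings cs Ts).[? c].
Proof.
elim: cs Ts => [|c' cs IH] [|T Ts] //=; rewrite /bindings /= ?fnd_fmap0 //.
by rewrite !fnd_set; case: eqP => [->|_] //; apply: IH.
Qed.

Lemma tmix_end_only (R : realFieldType) (Sort : Type)
    (Del1 Del2 : typing Sort (impr R)) : end_only Del1 -> tmix Del1 Del2 = Del1.
Proof.
move=> end1; apply/fmapP => c; rewrite fnd_tmix.
case E: Del1.[? c] => [T|] //=; rewrite (end1 _ _ E).
by case: Del2.[? c].
Qed.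

Lemma bindings_up (Sort A : Type) (rs : seq role) (Ts : seq (ltype Sort A)) c :
  (bindings [seq CSess 0 r | r <- rs] Ts).[? chan_up c] = None.
Proof.
elim: rs Ts => [|r rs IH] [|T Ts] //=; rewrite /bindings /= ?fnd_fmap0 //.
by rewrite fnd_set; case: eqP => [E|_]; [case: c E {IH}|apply: IH].
Qed.

Lemma fnd_up_cat (Sort A : Type) (Del : typing Sort A) rs Ts c :
  (typing_up Del + bindings [seq CSess 0 r | r <- rs] Ts).[? chan_up c]
  = Del.[? c].
Proof. by rewrite fnd_cat fnd_domf bindings_up typing_upE. Qed.

Lemma fnd_up_cat0 (Sort A : Type) (Del Del' : typing Sort A) r :
  (typing_up Del + Del').[? CSess 0 r] = Del'.[? CSess 0 r].
Proof. by rewrite fnd_cat typing_up0; case: fndP. Qed.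

Section Mixing.
Variables (R : realFieldType) (Sort Val : Type) (vsort : Val -> Sort -> Prop).
Implicit Types (Gam : sorting Sort (impr R)) (Del : typing Sort (impr R)).

Lemma has_sort_smix Gam1 Gam2 e S :
  has_sort vsort Gam1 e S -> has_sort vsort (smix Gam1 Gam2) e S.
Proof. by case=> [x T xT|v T vT]; [apply: TVar|apply: TVal]. Qed.

(* The two derivations may split their typings differently over a parallel
   composition; by the second component this only concerns end-typed channels. *)
Lemma typed_mix Gam1 (P : proc R Val) Del1 :
  typed vsort Gam1 P Del1 -> wf_proc P ->
  forall Gam2 Del2, typed vsort Gam2 P Del2 ->
    typed vsort (smix Gam1 Gam2) P (tmix Del1 Del2) /\
    (forall c T, Del1.[? c] = Some T -> Del2.[? c] = None -> T = LEnd).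
Proof.
elim=> {Gam1 P Del1}
  [Gam1 Del1 c r bs ts cD labs sorts _ IH sum1 probs
  |Gam1 Del1 c r bs ts cD labs _ IH
  |Gam1 Del1 endD
  |Gam1 Del1 Del1' P Q disj _ IHP _ IHQ
  |Gam1 Del1 P G rs Ts wfG uniq_rs sz_rs sz_Ts projG _ IH
  |Gam1 Del1 P Q Ss Ts wfTs _ IHP _ IHQ
  |Gam1 Del1 X vs cs Ss Ts XE sz_vs sorts endD sz_cs uniq_cs disj] /=.
- move=> /and3P[bs_gt0 _ wfP] Gam2 Del2 typ2.
  inversion typ2 as [? Del2' ? ? ? ts' cD' labs' sorts' typ' _ probs'| | | | | |]; subst.
  have sz : size ts = size ts'.
    by rewrite -(size_map (@lab _ _ _) ts) -labs labs' size_map.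
  have szb : size bs = size ts.
    by have /(congr1 size) := labs; rewrite !size_map.
  split.
    rewrite tmix_set /=; apply: TSelect => //.
    + by rewrite map_zipw.
    + move=> i b t bi /(onth_zipw_inv sz)[t1 [t2 [t1i t2i ->]]] /=.
      exact/has_sort_smix/(sorts i b).
    + move=> i b t bi /(onth_zipw_inv sz)[t1 [t2 [t1i t2i ->]]] /=.
      rewrite -tmix_set.
      exact: (IH i b t1 bi t1i (all_onth wfP bi) _ _ (typ' i b t2 bi t2i)).1.
    + move=> i b t bi /(onth_zipw_inv sz)[t1 [t2 [t1i t2i ->]]] /=.
      by apply: in_impr_mix; [apply: probs t1i|apply: probs' t2i].
  move=> k T; rewrite !fnd_set; case: eqP => // kc D1k D2k.
  (* The rest of the typing is shared by all alternatives, so the first one decides; it exists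
     because the process is well formed. *)
  case: bs bs_gt0 IH typ' szb sz wfP {sorts sorts' sum1 probs probs' labs labs' typ2}
    => // b bs _ IH typ' szb sz /andP[wfb _].
  have [t1 t1i] := onth_size szb (erefl : onth (b :: bs) 0 = Some b).
  have [t2 t2i] := onth_size sz t1i.
  by apply: ((IH 0%N b t1 erefl t1i wfb _ _ (typ' 0%N b t2 erefl t2i)).2 k);
    rewrite fnd_set; case: eqP.
- move=> /and3P[bs_gt0 _ wfP] Gam2 Del2 typ2.
  inversion typ2 as [|? Del2' ? ? ? ts' cD' labs' typ'| | | | |]; subst.
  have sz : size ts = size ts'.
    by rewrite -(size_map (@lab _ _ _) ts) -labs labs' size_map.
  have szb : size bs = size ts.
    by have /(congr1 size) := labs; rewrite !size_map.
  split.
    rewrite tmix_set /=; apply: TBranch => //.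
    + by rewrite map_zipw.
    + move=> i b t bi /(onth_zipw_inv sz)[t1 [t2 [t1i t2i ->]]] /=.
      rewrite -tmix_set.
      exact: (IH i b t1 bi t1i (all_onth wfP bi) _ _ (typ' i b t2 bi t2i)).1.
  move=> k T; rewrite !fnd_set; case: eqP => // kc D1k D2k.
  case: bs bs_gt0 IH typ' szb sz wfP {labs labs' typ2}
    => // b bs _ IH typ' szb sz /andP[wfb _].
  have [t1 t1i] := onth_size szb (erefl : onth (b :: bs) 0 = Some b).
  have [t2 t2i] := onth_size sz t1i.
  by apply: ((IH 0%N b t1 erefl t1i wfb _ _ (typ' 0%N b t2 erefl t2i)).2 k);
    rewrite fnd_set; case: eqP.
- move=> _ Gam2 Del2 _; split=> [|c T /endD //].
  by rewrite tmix_end_only //; apply: TEnd.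
- move=> /andP[wfP wfQ] Gam2 Del2 typ2.
  inversion typ2 as [| | |? D2 D2' ? ? disj2 typP typQ| | |]; subst.
  have [mixP endP] := IHP wfP _ _ typP.
  have [mixQ endQ] := IHQ wfQ _ _ typQ.
  split.
    suff -> : tmix (Del1 + Del1') (D2 + D2') = tmix Del1 D2 + tmix Del1' D2'.
      by apply: TConc.
    (* The critical channels are those that the two derivations assign to opposite components. Their
       type in the first derivation is [LEnd], which mixing leaves unchanged. *)
    apply/fmapP => c; rewrite fnd_tmix !fnd_cat !fnd_domf !fnd_tmix.
    have := fdisjointP disj c; have := fdisjointP disj2 c.
    rewrite !fnd_domf; have := endP c; have := endQ c.
    case: Del1.[? c] Del1'.[? c] D2.[? c] D2'.[? c]
      => [T1|] [T1'|] [T2|] [T2'|] //= eQ eP d2 d1;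
      try (by have := d1 isT); try (by have := d2 isT).
    * by rewrite (eP T1).
    * by rewrite (eQ T1').
  move=> c T; rewrite !fnd_cat !fnd_domf; have := endP c; have := endQ c.
  case: Del1.[? c] Del1'.[? c] D2.[? c] D2'.[? c]
    => [T1|] [T1'|] [T2|] [T2'|] //= eQ eP [<-] _; by [apply: eQ|apply: eP].
- move=> wfP Gam2 Del2 typ2.
  inversion typ2 as [| | | |? ? ? G2 rs2 Ts2 _ _ _ _ _ typP| |]; subst.
  have [mixP endP] := IH wfP _ _ typP.
  split; last first.
    by move=> c T D1c D2c; apply: (endP (chan_up c)); rewrite fnd_up_cat.
  (* The second derivation may list its roles in another order or use other roles, so the partner
     type is looked up by channel, and an endpoint without a partner keeps its type. *)
  pose g c T := oapp (@lmix R Sort T) T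
                  (bindings [seq CSess 0 r | r <- rs2] Ts2).[? c].
  pose Ts' := [seq g cT.1 cT.2 | cT <- zip [seq CSess 0 r | r <- rs] Ts].
  (* The listed projections as a function of the role; the default is never reached for a role in
     [rs]. *)
  pose T r := nth LEnd Ts (index r rs).
  have [r rsr|r _|G' [wfG' partG' projG']] :=
    @proj_reannotate _ _ (fun r => r \in rs) G T (fun r => g (CSess 0 r) (T r)).
  + have idx : (index r rs < size rs)%N by rewrite index_mem.
    apply: (projG (index r rs)); last by rewrite (onth_lt LEnd) ?sz_Ts.
    by rewrite (onth_lt 0%N) // nth_index.
  + by rewrite /g; case: (fnd _ _) => //= T2; apply: lerase_lmix.
  apply: (@TRes _ _ _ _ _ _ _ G' rs Ts') => //.
  + by rewrite wfG'.
  + by rewrite partG'.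
  + by rewrite size_map size2_zip ?size_map ?sz_Ts.
  + move=> i r U ri; rewrite onth_map; case E: (onth (zip _ _) i) => [[c V]|] //=.
    have [] := onth_zip _ E; first by rewrite size_map.
    rewrite onth_map ri /= => -[<-] Vi [<-].
    have rsr : r \in rs by apply/onthP; exists i.
    suff <- : T r = V by apply: projG'.
    have i_lt : (i < size rs)%N by rewrite -onthTE ri.
    have idx : index r rs = i by rewrite -(onth_nth 0%N _ _ _ ri) index_uniq.
    by rewrite /T idx; apply: onth_nth Vi.
  suff <- : tmix (typing_up Del1 + bindings [seq CSess 0 r | r <- rs] Ts)
                 (typing_up Del2 + bindings [seq CSess 0 r | r <- rs2] Ts2)
          = typing_up (tmix Del1 Del2) + bindings [seq CSess 0 r | r <- rs] Ts'.
    by [].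
  apply/fmapP; elim/chan_up_ind => [c|r].
    by rewrite fnd_tmix !fnd_up_cat fnd_tmix.
  by rewrite fnd_tmix !fnd_up_cat0 bindings_zip_map.
- move=> /andP[wfP wfQ] Gam2 Del2 typ2.
  inversion typ2 as [| | | | |? ? ? ? Ss2 Ts2 _ typP typQ|]; subst.
  (* The syntax of a definition records the numbers of its parameters, so these agree although their
     sorts and types may differ between the derivations. *)
  have eSs : size Ss2 = size Ss by [].
  have eTs : size Ts2 = size Ts by [].
  rewrite eTs in typP; rewrite eSs eTs.
  have [mixP _] := IHP wfP _ _ typP; have [mixQ endQ] := IHQ wfQ _ _ typQ.
  split=> //; rewrite -(size_zipw (@lmix R Sort) Ts Ts2); apply: TDef.
  + have /(congr1 (all id)) : map (@wf_ltype _ _) (zipw (@lmix R Sort) Ts Ts2)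
                            = map (@wf_ltype _ _) Ts.
      by apply: map_zipw => i T1 T2 _; apply: wf_lmix.
    by rewrite !all_map => ->.
  + by rewrite size_zipw -tmix_bindings.
  + by [].
- move=> _ Gam2 Del2 typ2.
  inversion typ2 as [| | | | | |? D2 ? ? ? Ss2 Ts2 XE2 sz_vs2 _ endD2 sz_cs2 _ disj2]; subst.
  split.
    suff -> : tmix (Del1 + bindings cs Ts) (D2 + bindings cs Ts2)
            = Del1 + bindings cs (zipw (@lmix R Sort) Ts Ts2).
      apply: (TCall (Ss := Ss)); rewrite ?size_zipw //.
      + by rewrite (onth_zipw _ XE XE2).
      + by move=> i v S vi Si; apply/has_sort_smix/(sorts i).
    apply/fmapP => c; rewrite fnd_tmix !fnd_cat !domf_bindings ?size_zipw //.
    case: ifP => _; first by rewrite -tmix_bindings fnd_tmix.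
    by rewrite -fnd_tmix tmix_end_only.
  move=> c T; rewrite !fnd_cat !domf_bindings //.
  case: ifP => [ccs _ E|_ + _]; last exact: endD.
  (* An argument channel is bound in both typings, against [E]; only the end-typed remainder can be
     missing from the second one. *)
  by have := domf_bindings c sz_cs2; rewrite fnd_domf E ccs.
Qed.

End Mixing.

Theorem theorem5 (R : realFieldType) (Sort : eqType) (Val : Type)
    (vsort : Val -> Sort -> Prop) (P : proc R Val)
    (Gam1 Gam2 Gam : sorting Sort (impr R))
    (Del1 Del2 Del : typing Sort (impr R)) :
  wf_proc P ->
  wf_sorting Gam1 -> wf_sorting Gam2 ->
  wf_typing Del1 -> wf_typing Del2 ->
  terase Del1 = terase Del2 ->
  serase Gam1 = serase Gam2 ->
  typed vsort Gam1 P Del1 ->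
  typed vsort Gam2 P Del2 ->
  scap Gam1 Gam2 = Some Gam ->
  tcap Del1 Del2 = Some Del ->
  typed vsort Gam P Del.
Proof.
move=> wfP _ _ _ _ eraseD _ typ1 typ2 capG capD.
(* Erasure keeps the domain, so the mix, whose domain is that of [Del1], has the domain of the
   intersection. *)
have dom12 : domf Del1 = domf Del2 by have /(congr1 (fun f => domf f)) := eraseD.
rewrite -(scap_smix capG) -(tcap_tmix dom12 capD).
exact: (typed_mix typ1 wfP typ2).1.
Qed.
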